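(* Let $n\ge1$ and let $\Gamma<{\bf O}(n,1)$ be a subgroup such that $\gamma^t\in\Gamma$ for all $\gamma\in\Gamma$. If $W$ is a $\Gamma$-invariant lightlike subspace of $\mathbb{R}^{n+1}_1$, then $JW^{\perp}$ is a $\Gamma$-invariant complement of $W$, with $W\oplus JW^{\perp}=\mathbb{R}^{n+1}_1$.
   Context: Minkowski space $\mathbb{R}^{n+1}_1$ is $\mathbb{R}^{n+1}$ with the pseudo inner product $\langle x,y\rangle=x^tJy=\sum_{i=1}^n x_iy_i-x_{n+1}y_{n+1}$, where $J=\mathrm{diag}(1,\dots,1,-1)$ ($n$ ones) and $t$ denotes transposition. The Lorentz group ${\bf O}(n,1)=\{A\in GL(n+1,\mathbb{R}):A^tJA=J\}$ acts by matrix multiplication. $W^\perp=\{x:\langle x,w\rangle=0\ \forall w\in W\}$ and $JW^\perp=\{Jv:v\in W^\perp\}$. A nonzero vector $x$ is spacelike, timelike or lightlike if $\langle x,x\rangle>0$, $<0$ or $=0$, respectively. A subspace is spacelike if all its nonzero vectors are spacelike, timelike if it contains a timelike vector, and lightlike if it is neither spacelike nor timelike. A subspace $W$ is $\Gamma$-invariant if $\gamma x\in W$ for all $\gamma\in\Gamma$, $x\in W$. *)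

(* Defs.v *)
From HB Require Import structures.
From mathcomp Require Import all_boot all_order all_algebra.
From mathcomp Require Import classical_sets reals.

Set Implicit Arguments.
Unset Strict Implicit.
Unset Printing Implicit Defensive.

Import Order.TTheory GRing.Theory Num.Theory.
Local Open Scope ring_scope.

(* Vectors of R^(n+1) are columns; the time coordinate is the last one. *)
Definition minkJ (R : realType) (n : nat) : 'M[R]_n.+1 :=
  diag_mx (\row_i (if i == ord_max then -1 else 1)).

Definition mink (R : realType) (n : nat) (x y : 'cV[R]_n.+1) : R :=
  (x^T *m minkJ R n *m y) 0 0.

Lemma minkE (R : realType) (n : nat) (x y : 'cV[R]_n.+1) :
  mink x y = \sum_(i < n) x (widen_ord (leqnSn n) i) 0 *
                          y (widen_ord (leqnSn n) i) 0
             - x ord_max 0 * y ord_max 0.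
Proof.
rewrite /mink -mulmxA mxE big_ord_recr /= mul_diag_mx !mxE eqxx mulN1r mulrN.
congr (_ - _); apply: eq_bigr => i _; rewrite !mxE ifF ?mul1r //.
by apply/negbTE; rewrite -val_eqE /= neq_ltn ltn_ord.
Qed.

Lemma minkC (R : realType) (n : nat) (x y : 'cV[R]_n.+1) : mink x y = mink y x.
Proof.
by rewrite !minkE mulrC; congr (_ - _); apply: eq_bigr => i _; rewrite mulrC.
Qed.

Definition lorentz (R : realType) (n : nat) : set 'M[R]_n.+1 :=
  [set A | A \in unitmx /\ A^T *m minkJ R n *m A = minkJ R n].

Definition lorentz_subgroup (R : realType) (n : nat)
    (Gamma : set 'M[R]_n.+1) : Prop :=
  [/\ (Gamma `<=` @lorentz R n)%classic,
      Gamma 1%:M,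
      forall A B, Gamma A -> Gamma B -> Gamma (A *m B) &
      forall A, Gamma A -> Gamma (invmx A)].

Definition invariant_under (R : realType) (n : nat)
    (Gamma : set 'M[R]_n.+1) (W : {vspace 'cV[R]_n.+1}) : Prop :=
  forall A x, Gamma A -> x \in W -> A *m x \in W.

Definition spacelike_vec (R : realType) (n : nat) (x : 'cV[R]_n.+1) : Prop :=
  x != 0 /\ 0 < mink x x.

Definition timelike_vec (R : realType) (n : nat) (x : 'cV[R]_n.+1) : Prop :=
  x != 0 /\ mink x x < 0.

Definition spacelike (R : realType) (n : nat)
    (W : {vspace 'cV[R]_n.+1}) : Prop :=
  forall x, x \in W -> x != 0 -> spacelike_vec x.

Definition timelike (R : realType) (n : nat)
    (W : {vspace 'cV[R]_n.+1}) : Prop :=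
  exists2 x, x \in W & timelike_vec x.

Definition lightlike (R : realType) (n : nat)
    (W : {vspace 'cV[R]_n.+1}) : Prop :=
  ~ spacelike W /\ ~ timelike W.

(* Only a basis of W is tested, so that the result is a {vspace _};
   perpP gives the usual description. *)
Definition perp (R : realType) (n : nat)
    (W : {vspace 'cV[R]_n.+1}) : {vspace 'cV[R]_n.+1} :=
  (\bigcap_(w <- vbasis W) lker (linfun (mulmx (w^T *m minkJ R n))))%VS.

Lemma perpP (R : realType) (n : nat) (W : {vspace 'cV[R]_n.+1})
    (x : 'cV[R]_n.+1) :
  x \in perp W <-> (forall w, w \in W -> mink x w = 0).
Proof.
have kerP (w : 'cV[R]_n.+1) :
    x \in lker (linfun (mulmx (w^T *m minkJ R n))) <-> mink x w = 0.
  rewrite memv_ker lfunE /= minkC /mink; split=> [/eqP -> | h].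
    by rewrite mxE.
  by apply/eqP/matrixP => i j; rewrite !ord1 h mxE.
have capP (s : seq 'cV[R]_n.+1) :
    x \in (\bigcap_(w <- s) lker (linfun (mulmx (w^T *m minkJ R n))))%VS <->
    {in s, forall w, mink x w = 0}.
  elim: s => [|w s IH]; first by rewrite big_nil memvf.
  rewrite big_cons memv_cap; split=> [/andP[/kerP hw /IH hs] u | h].
    by rewrite inE => /predU1P[-> //|]; apply: hs.
  apply/andP; split; first by apply/kerP/h; rewrite mem_head.
  by apply/IH => u us; apply: h; rewrite inE us orbT.
split=> [/capP hx w wW | hx]; last by apply/capP => w /vbasis_mem; apply: hx.
rewrite (coord_vbasis wW) /mink mulmx_sumr summxE big1 // => i _.
rewrite -scalemxAr mxE -/(mink _ _) hx ?mulr0 //.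
by rewrite mem_nth ?size_tuple.
Qed.

Definition Jperp (R : realType) (n : nat)
    (W : {vspace 'cV[R]_n.+1}) : {vspace 'cV[R]_n.+1} :=
  (linfun (mulmx (minkJ R n)) @: perp W)%VS.

Lemma JperpP (R : realType) (n : nat) (W : {vspace 'cV[R]_n.+1})
    (x : 'cV[R]_n.+1) :
  x \in Jperp W <-> (exists2 v, v \in perp W & x = minkJ R n *m v).
Proof.
split=> [/memv_imgP[v vW ->] | [v vW ->]].
  by exists v; rewrite // lfunE.
by apply/memv_imgP; exists v; rewrite // lfunE.
Qed.

(* Main.v *)
(** Since [J] squares to the identity, [J W^perp] is the orthogonal complement
    of [W] for the Euclidean scalar product: it meets [W] trivially because that
    product is definite, and it is invariant because the Euclidean adjoint of
    [A] is [A^T], which belongs to [Gamma] with [A]. *)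
Require Import Defs.
From HB Require Import structures.
From mathcomp Require Import all_boot all_order all_algebra.
From mathcomp Require Import classical_sets reals.

Set Implicit Arguments.
Unset Strict Implicit.
Unset Printing Implicit Defensive.

Import Order.TTheory GRing.Theory Num.Theory.
Local Open Scope ring_scope.

Lemma minkJ_sq (R : realType) (n : nat) : minkJ R n *m minkJ R n = 1%:M.
Proof.
rewrite /minkJ mulmx_diag -diag_const_mx; congr diag_mx; apply/rowP => i.
by rewrite !mxE; case: ifP => _; rewrite ?mulrNN mulr1.
Qed.

Lemma tr_minkJ (R : realType) (n : nat) : (minkJ R n)^T = minkJ R n.
Proof. exact: tr_diag_mx. Qed.

Lemma mem_Jperp (R : realType) (n : nat) (W : {vspace 'cV[R]_n.+1})
    (x : 'cV[R]_n.+1) :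
  x \in Jperp W <-> (forall w, w \in W -> x^T *m w = 0).
Proof.
split=> [/JperpP[v /perpP vW ->] w wW | xW].
  apply/matrixP => i j; rewrite !ord1 trmx_mul tr_minkJ [RHS]mxE.
  exact: vW.
(* As [minkJ] is its own inverse, the only possible preimage of [x] is [minkJ R n *m x]. *)
apply/JperpP; exists (minkJ R n *m x); last by rewrite mulmxA minkJ_sq mul1mx.
apply/perpP => w wW; rewrite /mink trmx_mul tr_minkJ.
by rewrite -(mulmxA x^T) minkJ_sq mulmx1 xW // mxE.
Qed.

Lemma tr_mulmx_eq0 (R : realDomainType) (m : nat) (x : 'cV[R]_m) :
  x^T *m x = 0 -> x = 0.
Proof.
(* The single entry of [x^T *m x] is a sum of squares over an ordered ring, so each square
   vanishes. *)
move=> /matrixP /(_ 0 0) /eqP; rewrite !mxE psumr_eq0 => [/allP x0|i _].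
  apply/colP => i; have /implyP/(_ isT) := x0 i (mem_index_enum i).
  by rewrite mxE mulf_eq0 orbb mxE => /eqP.
by rewrite mxE -expr2 sqr_ge0.
Qed.

Lemma capv_Jperp (R : realType) (n : nat) (W : {vspace 'cV[R]_n.+1}) :
  (W :&: Jperp W)%VS = 0%VS.
Proof.
apply/eqP; rewrite -subv0; apply/subvP => x.
rewrite memv_cap memv0 => /andP[xW /mem_Jperp xJ].
exact/eqP/tr_mulmx_eq0/xJ.
Qed.

(** Rank-nullity for the map [f] pairing a vector with a basis of [W]: its image has dimension at
    most [\dim W], and its kernel lies in [Jperp W]. *)
Lemma dim_Jperp (R : realType) (n : nat) (W : {vspace 'cV[R]_n.+1}) :
  (\dim {:'cV[R]_n.+1} <= \dim W + \dim (Jperp W))%N.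
Proof.
(* The rows of [B] are the transposed basis vectors, so [B *m x] lists their Euclidean products with
   [x]. *)
pose B := \matrix_(i < \dim W, j < n.+1) (vbasis W)`_i j 0.
pose f : 'Hom('cV[R]_n.+1, 'cV[R]_(\dim W)) := linfun (mulmx B).
rewrite -(limg_ker_dim f fullv) capfv addnC leq_add //.
  rewrite (leq_trans (dimvS (subvf _))) // dimvf.
  by rewrite /dim /= muln1.
apply/dimvS/subvP => x; rewrite memv_ker lfunE /= => /eqP Bx0.
(* By linearity in [w], orthogonality to the basis vectors suffices. *)
apply/mem_Jperp => w wW; rewrite (coord_vbasis wW) mulmx_sumr big1 // => i _.
rewrite -scalemxAr; suff -> : x^T *m (vbasis W)`_i = 0 by rewrite scaler0.
apply/matrixP => a b; rewrite !ord1 [RHS]mxE.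
have /matrixP/(_ i 0) := Bx0; rewrite [RHS]mxE => <-; rewrite !mxE.
by apply: eq_bigr => j _; rewrite !mxE mulrC.
Qed.

(** The intersection being trivial, the dimensions add up, and the lower bound [dim_Jperp] forces
    the sum to fill the space. *)
Lemma addv_Jperp (R : realType) (n : nat) (W : {vspace 'cV[R]_n.+1}) :
  (W + Jperp W)%VS = fullv.
Proof.
apply/eqP; rewrite eqEdim subvf dimv_disjoint_sum ?capv_Jperp //.
exact: dim_Jperp.
Qed.

Lemma invariant_Jperp (R : realType) (n : nat) (Gamma : set 'M[R]_n.+1)
    (W : {vspace 'cV[R]_n.+1}) :
  (forall A, Gamma A -> Gamma A^T) ->
  invariant_under Gamma W -> invariant_under Gamma (Jperp W).
Proof.
move=> hT hinv A x GA /mem_Jperp xJ; apply/mem_Jperp => w wW.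
(* The transpose moves [A] onto [w], and [A^T *m w] stays in [W]. *)
by rewrite trmx_mul -mulmxA; apply/xJ/hinv => //; apply: hT.
Qed.

Theorem proposition3p3 (R : realType) (n : nat) (hn : (1 <= n)%N)
    (Gamma : set 'M[R]_n.+1) (hGamma : lorentz_subgroup Gamma)
    (hT : forall A, Gamma A -> Gamma A^T)
    (W : {vspace 'cV[R]_n.+1})
    (hinv : invariant_under Gamma W) (hlight : lightlike W) :
  [/\ invariant_under Gamma (Jperp W),
      directv (W + Jperp W)%VS &
      (W + Jperp W)%VS = fullv].
Proof.
split; first exact: invariant_Jperp.
- exact/directv_addP/capv_Jperp.
- exact: addv_Jperp.
Qed.
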